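(* For every type $\sigma$, the system $\mathsf P$ proves $\Omega$-$\mathsf{CA}$: for every standard $F^{(\sigma\times0)\to0}$ and every $M^0\in\Omega$, if $F(\cdot,M)$ is $\Omega$-invariant, i.e. \[ (\forall^{\mathrm{st}}x^\sigma)(\forall N^0\in\Omega)\big[F(x,M)=_0F(x,N)\big], \] then there is a standard $G^{\sigma\to0}$ such that \[ (\forall^{\mathrm{st}}x^\sigma)(\forall N^0\in\Omega)\big[G(x)=_0F(x,N)\big]. \]
   Context: Framework. $\mathsf{E\text{-}PA}^{\omega*}$ is Peano arithmetic in all finite types with the axiom of extensionality, with additional types $\rho^*$ of finite sequences; type $0$ = naturals. The language of $\mathsf P$ adds a predicate $\mathrm{st}$ (''standard'') for every type; $(\forall^{\mathrm{st}}x)\varphi\equiv(\forall x)(\mathrm{st}(x)\to\varphi)$, $(\exists^{\mathrm{st}}x)\varphi\equiv(\exists x)(\mathrm{st}(x)\wedge\varphi)$; internal = not containing $\mathrm{st}$. $\mathsf P$ is $\mathsf{E\text{-}PA}^{\omega*}$ plus: (i) $\mathrm{st}(x)\wedge x=y\to\mathrm{st}(y)$; (ii) $\mathrm{st}(t)$ for each closed term $t$ of $\mathsf{E\text{-}PA}^{\omega*}$; (iii) $\mathrm{st}(f)\wedge\mathrm{st}(x)\to\mathrm{st}(f(x))$; (iv) external induction $[\Phi(0)\wedge(\forall^{\mathrm{st}}n^0)(\Phi(n)\to\Phi(n+1))]\to(\forall^{\mathrm{st}}m^0)\Phi(m)$ for every formula $\Phi$; (v) $\mathsf{HAC}_{\mathrm{int}}$: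 for internal $\varphi$, $(\forall^{\mathrm{st}}x^\rho)(\exists^{\mathrm{st}}y^\tau)\varphi(x,y)\to(\exists^{\mathrm{st}}F^{\rho\to\tau^*})(\forall^{\mathrm{st}}x^\rho)(\exists y\in F(x))\varphi(x,y)$; (vi) idealisation: for internal $\varphi$ with arbitrary parameters, $(\forall^{\mathrm{st}}x^{\sigma^*})(\exists y^\tau)(\forall z^\sigma\in x)\varphi(z,y)\to(\exists y^\tau)(\forall^{\mathrm{st}}x^\sigma)\varphi(x,y)$. $N^0\in\Omega$ means $\neg\mathrm{st}(N)$ ($N$ is infinite), and $(\forall N\in\Omega)$ ranges over such $N$. *)

(* Defs.v *)
(* A deep embedding of the system P over E-PA^{omega*}. *)
From Stdlib Require Import List.
Import ListNotations.

Set Implicit Arguments.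

(* There are no product types: a functional of type (s x t) -> r is, as usual
   in this setting, the curried one of type s -> (t -> r), and F(x, y) is
   F x y. *)
Inductive ty : Type :=
| Nat : ty
| Arr : ty -> ty -> ty
| Seq : ty -> ty.

Declare Scope ty_scope.
Delimit Scope ty_scope with ty.
Bind Scope ty_scope with ty.
Notation "s '==>' t" := (Arr s t) (at level 55, right associativity) : ty_scope.

Definition ctx := list ty.

(* Well-typed de Bruijn variables; position 0 is the innermost binder. *)
Inductive var : ctx -> ty -> Type :=
| VZ : forall G s, var (s :: G) s
| VS : forall G s t, var G t -> var (s :: G) t.
Arguments VZ {G s}.
Arguments VS {G s t} _.

Inductive const : ty -> Type :=
| CZero : const Nat
| CSucc : const (Nat ==> Nat)
| CPi (s t : ty) : const (s ==> t ==> s)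
| CSigma (r s t : ty) : const ((r ==> s ==> t) ==> (r ==> s) ==> r ==> t)
| CRec (r : ty) : const (Nat ==> r ==> (r ==> Nat ==> r) ==> r)
| CNil (s : ty) : const (Seq s)
| CCons (s : ty) : const (s ==> Seq s ==> Seq s)
| CLrec (s r : ty) : const (Seq s ==> r ==> (r ==> s ==> Seq s ==> r) ==> r).

Inductive tm (G : ctx) : ty -> Type :=
| TVar : forall t, var G t -> tm G t
| TConst : forall t, const t -> tm G t
| TApp : forall s t, tm G (s ==> t) -> tm G s -> tm G t.
Arguments TVar {G t} _.
Arguments TConst {G t} _.
Arguments TApp {G s t} _ _.

Declare Scope tm_scope.
Delimit Scope tm_scope with tm.
Bind Scope tm_scope with tm.
Notation "t @ u" := (TApp t u) (at level 40, left associativity) : tm_scope.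
Local Open Scope tm_scope.

Definition tzero {G} : tm G Nat := TConst CZero.
Definition tsucc {G} (t : tm G Nat) : tm G Nat := TConst CSucc @ t.
Definition tpi {G} s t : tm G (s ==> t ==> s) := TConst (CPi s t).
Definition tsigma {G} r s t : tm G ((r ==> s ==> t) ==> (r ==> s) ==> r ==> t) :=
  TConst (CSigma r s t).
Definition tnil {G} s : tm G (Seq s) := TConst (CNil s).
Definition tcons {G s} (a : tm G s) (x : tm G (Seq s)) : tm G (Seq s) :=
  TConst (CCons s) @ a @ x.
Definition trec {G r} (n : tm G Nat) (y : tm G r) (z : tm G (r ==> Nat ==> r)) :
  tm G r := TConst (CRec r) @ n @ y @ z.
Definition tlrec {G s r} (x : tm G (Seq s)) (y : tm G r)
  (z : tm G (r ==> s ==> Seq s ==> r)) : tm G r :=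
  TConst (CLrec s r) @ x @ y @ z.

Definition v0 {G a} : tm (a :: G) a := TVar VZ.
Definition v1 {G a b} : tm (a :: b :: G) b := TVar (VS VZ).
Definition v2 {G a b c} : tm (a :: b :: c :: G) c := TVar (VS (VS VZ)).
Definition v4 {G a b c d e} : tm (a :: b :: c :: d :: e :: G) e :=
  TVar (VS (VS (VS (VS VZ)))).
Definition v5 {G a b c d e f} : tm (a :: b :: c :: d :: e :: f :: G) f :=
  TVar (VS (VS (VS (VS (VS VZ))))).

(* The assignment on s :: G that sends variable 0 to a and the others by f. *)
Definition scons {P : ty -> Type} {G s} (a : P s) (f : forall t, var G t -> P t)
  t (x : var (s :: G) t) : P t :=
  match x in var G' t' return
    match G' with
    | [] => unit
    | s' :: G'' => P s' -> (forall u, var G'' u -> P u) -> P t'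
    end
  with
  | VZ => fun a _ => a
  | VS y => fun _ f => f _ y
  end a f.

Definition sub (G D : ctx) := forall t, var G t -> tm D t.

Fixpoint tsubst {G D} (f : sub G D) {t} (u : tm G t) : tm D t :=
  match u with
  | TVar x => f _ x
  | TConst c => TConst c
  | TApp u1 u2 => tsubst f u1 @ tsubst f u2
  end.

Definition shift {G s} : sub G (s :: G) := fun t x => TVar (VS x).
Definition up {G D} s (f : sub G D) : sub (s :: G) (s :: D) :=
  scons (P := tm (s :: D)) v0 (fun t x => tsubst shift (f t x)).
Definition inst {G s} (a : tm G s) : sub (s :: G) G :=
  scons (P := tm G) a (fun t x => TVar x).
Definition inst_succ {G} : sub (Nat :: G) (Nat :: G) :=
  scons (P := tm (Nat :: G)) (tsucc v0) shift.
Definition sub_nil {G} : sub [] G := fun t x =>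
  match x in var G' t' return match G' with [] => tm G t' | _ => unit end with
  | VZ => tt
  | VS _ => tt
  end.

Definition twk {G s t} (u : tm G t) : tm (s :: G) t := tsubst shift u.

(* Bracket abstraction: lambda is not primitive, only the combinators are. *)
Fixpoint lam {G s t} (u : tm (s :: G) t) : tm G (s ==> t) :=
  match u in tm _ t' return tm G (s ==> t') with
  | TVar x =>
      scons (P := fun t' => tm G (s ==> t'))
        (tsigma s (s ==> s) s @ tpi s (s ==> s) @ tpi s s)
        (fun t' y => tpi t' s @ TVar y) x
  | TConst c => tpi _ s @ TConst c
  | TApp u1 u2 => tsigma _ _ _ @ lam u1 @ lam u2
  end.

Definition tplus {G} (m n : tm G Nat) : tm G Nat :=
  trec n m (lam (lam (tsucc v1))).

Fixpoint tdefault {G} (s : ty) : tm G s :=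
  match s with
  | Nat => tzero
  | Arr a b => tpi b a @ tdefault b
  | Seq a => tnil a
  end.

(* |x| *)
Definition tlen {G s} (x : tm G (Seq s)) : tm G Nat :=
  tlrec x tzero (lam (lam (lam (tsucc v2)))).

(* (x)_i, with <>_i the default object, (C a x)_0 = a and
   (C a x)_{i+1} = (x)_i; in the step, the variables are, from the outside,
   the function i |-> (x)_i, then a, x, i. *)
Definition tnth {G s} (x : tm G (Seq s)) (i : tm G Nat) : tm G s :=
  tlrec x (tdefault (Nat ==> s))
    (lam (lam (lam (lam (trec v0 v2 (lam (lam (v5 @ v0)))))))) @ i.

Inductive fm (G : ctx) : Type :=
| FEq : forall t, tm G t -> tm G t -> fm G
| FSt : forall t, tm G t -> fm G
| FBot : fm G
| FImp : fm G -> fm G -> fm G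
| FAnd : fm G -> fm G -> fm G
| FOr : fm G -> fm G -> fm G
| FAll : forall s, fm (s :: G) -> fm G
| FEx : forall s, fm (s :: G) -> fm G.
Arguments FEq {G t} _ _.
Arguments FSt {G t} _.
Arguments FBot {G}.
Arguments FImp {G} _ _.
Arguments FAnd {G} _ _.
Arguments FOr {G} _ _.
Arguments FAll {G} s _.
Arguments FEx {G} s _.

Declare Scope fm_scope.
Delimit Scope fm_scope with fm.
Bind Scope fm_scope with fm.
Notation "t '==' u" := (FEq t%tm u%tm) (at level 70, no associativity) : fm_scope.
Notation "A '/.\' B" := (FAnd A B) (at level 80, right associativity) : fm_scope.
Notation "A '\./' B" := (FOr A B) (at level 85, right associativity) : fm_scope.
Notation "A '-.>' B" := (FImp A B) (at level 90, right associativity) : fm_scope.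
Notation "'\neg' A" := (FImp A FBot) (at level 75, right associativity) : fm_scope.
Local Open Scope fm_scope.

Fixpoint fsubst {G D} (f : sub G D) (A : fm G) : fm D :=
  match A with
  | FEq t u => tsubst f t == tsubst f u
  | FSt t => FSt (tsubst f t)
  | FBot => FBot
  | FImp A B => fsubst f A -.> fsubst f B
  | FAnd A B => fsubst f A /.\ fsubst f B
  | FOr A B => fsubst f A \./ fsubst f B
  | FAll s A => FAll s (fsubst (up f) A)
  | FEx s A => FEx s (fsubst (up f) A)
  end.

Definition fwk {G s} (A : fm G) : fm (s :: G) := fsubst shift A.

Fixpoint internal {G} (A : fm G) : Prop :=
  match A with
  | FEq _ _ => True
  | FSt _ => False
  | FBot => True
  | FImp A B | FAnd A B | FOr A B => internal A /\ internal B
  | FAll _ A | FEx _ A => internal A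
  end.

Definition FAllSt {G} s (A : fm (s :: G)) : fm G := FAll s (FSt v0 -.> A).
Definition FExSt {G} s (A : fm (s :: G)) : fm G := FEx s (FSt v0 /.\ A).

Definition FInf {G} (n : tm G Nat) : fm G := \neg FSt n.
Definition FAllInf {G} (A : fm (Nat :: G)) : fm G := FAll Nat (FInf v0 -.> A).

Definition FLt {G} (m n : tm G Nat) : fm G :=
  FEx Nat (tplus (twk m) (tsucc v0) == twk n).
Definition FIn {G s} (a : tm G s) (x : tm G (Seq s)) : fm G :=
  FEx Nat (FLt v0 (tlen (twk x)) /.\ (twk a == tnth (twk x) v0)).

(* Axioms may contain free variables from the context G (the parameters).
   Equality is primitive at every type.  Leibniz's law and induction are schemes
   of E-PA^{omega*}, hence restricted to internal formulas; the replacement of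
   equals under st is the separate axiom ax_st_eq.  The scheme ax_leibniz
   includes x = y -> f x = f y, and ax_ext adds that pointwise equal functionals
   are equal. *)

Inductive EPA_ax {G : ctx} : fm G -> Prop :=
| ax_refl : forall s (t : tm G s), EPA_ax (t == t)
| ax_leibniz : forall s (t u : tm G s) (A : fm (s :: G)), internal A ->
    EPA_ax (t == u -.> fsubst (inst t) A -.> fsubst (inst u) A)
| ax_ext : forall s t (f g : tm G (s ==> t)),
    EPA_ax (FAll s (twk f @ v0 == twk g @ v0) -.> f == g)
| ax_succ_neq0 : forall n : tm G Nat, EPA_ax (\neg (tsucc n == tzero))
| ax_succ_inj : forall m n : tm G Nat, EPA_ax (tsucc m == tsucc n -.> m == n)
| ax_ind : forall A : fm (Nat :: G), internal A ->
    EPA_ax (fsubst (inst tzero) A -.> FAll Nat (A -.> fsubst inst_succ A) -.>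
            FAll Nat A)
| ax_pi : forall s t (x : tm G s) (y : tm G t), EPA_ax (tpi s t @ x @ y == x)
| ax_sigma : forall r s t (x : tm G (r ==> s ==> t)) (y : tm G (r ==> s))
    (z : tm G r), EPA_ax (tsigma r s t @ x @ y @ z == x @ z @ (y @ z))
| ax_rec0 : forall r (y : tm G r) z, EPA_ax (trec tzero y z == y)
| ax_recS : forall r n (y : tm G r) z,
    EPA_ax (trec (tsucc n) y z == z @ trec n y z @ n)
| ax_lrec_nil : forall s r (y : tm G r) z, EPA_ax (tlrec (tnil s) y z == y)
| ax_lrec_cons : forall s r (a : tm G s) x (y : tm G r) z,
    EPA_ax (tlrec (tcons a x) y z == z @ tlrec x y z @ a @ x)
| ax_seq : forall s (x : tm G (Seq s)),
    EPA_ax (x == tnil s \./ FEx s (FEx (Seq s) (twk (twk x) == tcons v1 v0))).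

Inductive P_ax {G : ctx} : fm G -> Prop :=
| ax_EPA : forall A, EPA_ax A -> P_ax A
| ax_st_eq : forall s (x y : tm G s), P_ax (FSt x /.\ x == y -.> FSt y)
| ax_st_closed : forall s (t : tm [] s), P_ax (FSt (tsubst sub_nil t))
| ax_st_app : forall s t (f : tm G (s ==> t)) (x : tm G s),
    P_ax (FSt f /.\ FSt x -.> FSt (f @ x))
| ax_ext_ind : forall A : fm (Nat :: G),
    P_ax (fsubst (inst tzero) A /.\ FAllSt (A -.> fsubst inst_succ A) -.>
          FAllSt A)
(* HAC_int: in A, variable 1 is x and variable 0 is y; the substitution
   makes room for the bound variable F below them. *)
| ax_HAC : forall r t (A : fm (t :: r :: G)), internal A ->
    P_ax (FAllSt (FExSt A) -.>
          FExSt (s := r ==> Seq t) (FAllSt (s := r) (FEx t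
            (FIn v0 (v2 @ v1) /.\ fsubst (up (up shift)) A))))
(* Idealisation: in A, variable 0 is z and variable 1 is y. *)
| ax_ideal : forall s t (A : fm (s :: t :: G)), internal A ->
    P_ax (FAllSt (s := Seq s) (FEx t (FAll s
            (FIn v0 v2 -.> fsubst (up (up shift)) A))) -.>
          FEx t (FAllSt A)).

Inductive prv (Ax : forall G, fm G -> Prop) (G : ctx) (H : list (fm G)) :
  fm G -> Prop :=
| prv_ax : forall A, Ax G A -> prv Ax H A
| prv_hyp : forall A, In A H -> prv Ax H A
| prv_impI : forall A B, prv Ax (A :: H) B -> prv Ax H (A -.> B)
| prv_impE : forall A B, prv Ax H (A -.> B) -> prv Ax H A -> prv Ax H B
| prv_andI : forall A B, prv Ax H A -> prv Ax H B -> prv Ax H (A /.\ B)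
| prv_andE1 : forall A B, prv Ax H (A /.\ B) -> prv Ax H A
| prv_andE2 : forall A B, prv Ax H (A /.\ B) -> prv Ax H B
| prv_orI1 : forall A B, prv Ax H A -> prv Ax H (A \./ B)
| prv_orI2 : forall A B, prv Ax H B -> prv Ax H (A \./ B)
| prv_orE : forall A B C, prv Ax H (A \./ B) -> prv Ax (A :: H) C ->
    prv Ax (B :: H) C -> prv Ax H C
| prv_raa : forall A, prv Ax ((\neg A) :: H) FBot -> prv Ax H A
| prv_allI : forall s A, prv Ax (map (@fwk G s) H) A -> prv Ax H (FAll s A)
| prv_allE : forall s A (t : tm G s), prv Ax H (FAll s A) ->
    prv Ax H (fsubst (inst t) A)
| prv_exI : forall s A (t : tm G s), prv Ax H (fsubst (inst t) A) ->
    prv Ax H (FEx s A)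
| prv_exE : forall s A C, prv Ax H (FEx s A) ->
    prv Ax (A :: map (@fwk G s) H) (fwk C) -> prv Ax H C.

Definition P_proves (A : fm []) : Prop := prv (@P_ax) [] A.

Definition Omega_invariant {G s} (F : tm G (s ==> Nat ==> Nat)) (M : tm G Nat) :
  fm G :=
  FAllSt (s := s) (FAllInf (twk (twk F) @ v1 @ twk (twk M) ==
                            twk (twk F) @ v1 @ v0)).

(* In the last formula the variables are, from the outside, F, M, G, x, N. *)
Definition Omega_CA (s : ty) : fm [] :=
  FAllSt (s := s ==> Nat ==> Nat) (FAllInf
    (Omega_invariant v1 v0 -.>
     FExSt (s := s ==> Nat) (FAllSt (s := s) (FAllInf
       (v2 @ v1 == v4 @ v1 @ v0))))).

(* Main.v *)
(** Call [k] stable for [x] if [F(x, d + k) = F(x, k)] for all [d].  For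
    standard [x], Omega-invariance makes every infinite [k] stable, since [d + k]
    is then infinite too, so underspill yields a standard stable [k].  HAC_int
    provides a standard [f] such that the finite sequence [f(x)] contains a
    stable number.  The sum of the entries of [f(x)] is standard and lies above
    that number and below every infinite [N], hence [G(x) := F(x, sum f(x))]
    equals [F(x, N)]. *)
From Stdlib Require Import List Morphisms Setoid.
Import ListNotations.
Require Import Defs.

Set Implicit Arguments.
Local Open Scope tm_scope.
Local Open Scope fm_scope.

Notation "H |-- A" := (prv (@P_ax) H A%fm) (at level 95, no associativity).

(** * Substitution *)

(** Case analysis on a variable whose context is a cons: the [match] returns a statement computed
    from the context index, with [P] quantified inside because its type depends on that index. *)
Lemma var_cons_ind G s (P : forall t, var (s :: G) t -> Prop) :
  P s VZ -> (forall t y, P t (VS y)) -> forall t x, P t x.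
Proof.
  intros HZ HS t x; revert P HZ HS.
  refine (match x as x' in var G' t' return
    match G' as G'' return var G'' t' -> Prop with
    | [] => fun _ => True
    | s' :: G'' => fun x' => forall P : forall t, var (s' :: G'') t -> Prop,
        P s' VZ -> (forall t y, P t (VS y)) -> P t' x'
    end x' with VZ => _ | VS y => _ end); auto.
Qed.

Lemma var_nil_ind (P : forall t, var [] t -> Prop) t x : P t x.
Proof.
  refine (match x as x' in var G' t' return
    match G' as G'' return var G'' t' -> Prop with
    | [] => fun x' => P t' x'
    | _ :: _ => fun _ => True
    end x' with VZ => I | VS _ => I end).
Qed.

Lemma tsubst_ext G D (f g : sub G D) t (u : tm G t) :
  (forall t x, f t x = g t x) -> tsubst f u = tsubst g u.
Proof. intros E; induction u; cbn; congruence. Qed.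

Lemma tsubst_comp G D K (f : sub G D) (g : sub D K) t (u : tm G t) :
  tsubst g (tsubst f u) = tsubst (fun t x => tsubst g (f t x)) u.
Proof. induction u; cbn; congruence. Qed.

Lemma tsubst_id G t (u : tm G t) : tsubst (fun t x => TVar x) u = u.
Proof. induction u; cbn; congruence. Qed.

Lemma tsubst_inst_twk G s t (a : tm G s) (u : tm G t) :
  tsubst (inst a) (twk u) = u.
Proof. unfold twk; rewrite tsubst_comp; apply tsubst_id. Qed.

Lemma tsubst_scons_twk G D s t (a : tm D s) (f : sub G D) (u : tm G t) :
  tsubst (scons (P := tm D) a f) (twk u) = tsubst f u.
Proof. unfold twk; rewrite tsubst_comp; apply tsubst_ext; reflexivity. Qed.

Lemma tsubst_inst_succ_twk G t (u : tm G t) : tsubst inst_succ (twk u) = twk u.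
Proof. apply tsubst_scons_twk. Qed.

Lemma tsubst_up_twk G D s t (f : sub G D) (u : tm G t) :
  tsubst (up f) (twk u) = twk (s := s) (tsubst f u).
Proof. unfold up, twk; rewrite !tsubst_comp; apply tsubst_ext; reflexivity. Qed.

Lemma tsubst_tplus G D (f : sub G D) a b :
  tsubst f (tplus a b) = tplus (tsubst f a) (tsubst f b).
Proof. reflexivity. Qed.

Lemma tsubst_tsucc G D (f : sub G D) a : tsubst f (tsucc a) = tsucc (tsubst f a).
Proof. reflexivity. Qed.

Lemma tsubst_tlen G D (f : sub G D) s (x : tm G (Seq s)) :
  tsubst f (tlen x) = tlen (tsubst f x).
Proof. reflexivity. Qed.

Lemma tsubst_tdefault G D (f : sub G D) s : tsubst f (tdefault s) = tdefault s.
Proof. induction s; cbn; [reflexivity | now rewrite IHs2 | reflexivity]. Qed.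

Lemma tsubst_tnth G D (f : sub G D) s (x : tm G (Seq s)) i :
  tsubst f (tnth x i) = tnth (tsubst f x) (tsubst f i).
Proof.
  unfold tnth, tlrec; cbn [tsubst]; rewrite tsubst_tdefault; reflexivity.
Qed.

Lemma tsubst_inst_v0 G s (a : tm G s) : tsubst (inst a) v0 = a.
Proof. reflexivity. Qed.

Lemma tsubst_inst_succ_v0 G : tsubst (@inst_succ G) v0 = tsucc v0.
Proof. reflexivity. Qed.

Lemma twk_tplus G s (a b : tm G Nat) :
  twk (s := s) (tplus a b) = tplus (twk a) (twk b).
Proof. reflexivity. Qed.

Lemma twk_tsucc G s (a : tm G Nat) : twk (s := s) (tsucc a) = tsucc (twk a).
Proof. reflexivity. Qed.

Lemma twk_TApp G r s t (f : tm G (s ==> t)) a :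
  twk (s := r) (f @ a) = twk f @ twk a.
Proof. reflexivity. Qed.

#[local] Hint Rewrite tsubst_inst_twk tsubst_inst_succ_twk tsubst_up_twk
  tsubst_tplus tsubst_tsucc tsubst_tlen tsubst_tnth
  tsubst_inst_v0 tsubst_inst_succ_v0
  twk_tplus twk_tsucc : tm_subst.

Ltac simpl_subst :=
  repeat progress (cbn [fsubst tsubst]; autorewrite with tm_subst).
Ltac simpl_subst_in p :=
  repeat progress (cbn [fsubst tsubst] in p; autorewrite with tm_subst in p).
(** Membership is checked up to conversion, so a weakened hypothesis is found in whatever form it is
    displayed. *)
Ltac hyp := apply prv_hyp; repeat (first [left; reflexivity | right]).
Ltac name_hyps K := match goal with |- prv _ ?L _ => set (K := L) in * end.
Ltac spec p u := apply prv_allE with (t := u) in p; simpl_subst_in p.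

(* [d] stands on the left because [tplus] recurses on its right argument. *)
Definition FLe {G} (k n : tm G Nat) : fm G :=
  FEx Nat (twk n == tplus v0 (twk k)).

Lemma fsubst_FLe G D (f : sub G D) k n :
  fsubst f (FLe k n) = FLe (tsubst f k) (tsubst f n).
Proof. unfold FLe; simpl_subst; reflexivity. Qed.

Lemma fsubst_FIn G D (f : sub G D) s (a : tm G s) x :
  fsubst f (FIn a x) = FIn (tsubst f a) (tsubst f x).
Proof. unfold FIn, FLt; simpl_subst; reflexivity. Qed.

Lemma fwk_FLe G s (k n : tm G Nat) :
  fwk (s := s) (FLe k n) = FLe (twk k) (twk n).
Proof. apply fsubst_FLe. Qed.

#[local] Hint Rewrite fwk_FLe fsubst_FLe fsubst_FIn : tm_subst.

(** * Derived rules *)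

Lemma incl_head T (A : T) H H' : incl H H' -> incl (A :: H) (A :: H').
Proof. intros I B [<- | i]; [now left | right; auto]. Qed.

Lemma prv_weaken Ax G (H H' : list (fm G)) A :
  prv Ax H A -> incl H H' -> prv Ax H' A.
Proof.
  intros p; revert H'; induction p; intros H' I.
  - now apply prv_ax.
  - apply prv_hyp; auto.
  - now apply prv_impI, IHp, incl_head.
  - eapply prv_impE; eauto.
  - apply prv_andI; auto.
  - eapply prv_andE1; eauto.
  - eapply prv_andE2; eauto.
  - apply prv_orI1; auto.
  - apply prv_orI2; auto.
  - eapply prv_orE; [eauto | now apply IHp2, incl_head | now apply IHp3, incl_head].
  - now apply prv_raa, IHp, incl_head.
  - apply prv_allI, IHp, incl_map, I.
  - apply prv_allE; auto.
  - eapply prv_exI; eauto.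
  - eapply prv_exE; [eauto |].
    apply IHp2, incl_head, incl_map, I.
Qed.

(** Mostly serves to store a derived formula among the hypotheses, which [prv_allI] and [prv_exE]
    then lift to the extended context. *)
Lemma prv_cut G (H : list (fm G)) A C : H |-- A -> A :: H |-- C -> H |-- C.
Proof. intros p q; eapply prv_impE; [apply prv_impI, q | exact p]. Qed.

Lemma prv_head Ax G (H : list (fm G)) A : prv Ax (A :: H) A.
Proof. apply prv_hyp; now left. Qed.

Lemma prv_tail Ax G (H : list (fm G)) A B : prv Ax H B -> prv Ax (A :: H) B.
Proof. intros p; apply (prv_weaken p); now apply incl_tl, incl_refl. Qed.

Lemma prv_botE G (H : list (fm G)) C : H |-- FBot -> H |-- C.
Proof. intros p; now apply prv_raa, prv_tail. Qed.

Lemma prv_EPA G (H : list (fm G)) A : EPA_ax A -> H |-- A.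
Proof. intros a; now apply prv_ax, ax_EPA. Qed.

(** Provable equality as a binary relation, so that setoid rewriting carries out equational
    reasoning inside the object system. *)
Definition teq {G} (H : list (fm G)) {t} (a b : tm G t) : Prop := H |-- a == b.

Lemma prv_subst_eq G (H : list (fm G)) s (t u : tm G s) A : internal A ->
  H |-- t == u -> H |-- fsubst (inst t) A -> H |-- fsubst (inst u) A.
Proof.
  intros i e p; eapply prv_impE; [eapply prv_impE |]; [| exact e | exact p].
  now apply prv_EPA, ax_leibniz.
Qed.

Global Instance teq_equiv G (H : list (fm G)) t : Equivalence (@teq G H t).
Proof.
  split; unfold teq.
  - intros a; apply prv_EPA, ax_refl.
  - intros a b e.
    (* Leibniz's law for [v0 == twk a] carries [a == a] over to [b == a]. *)
    assert (p := @prv_subst_eq _ H _ a b (v0 == twk a) I e).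
    cbn [fsubst] in p; rewrite !tsubst_inst_twk in p.
    apply p, prv_EPA, ax_refl.
  - intros a b c e1 e2.
    assert (p := @prv_subst_eq _ H _ b c (twk a == v0) I e2).
    cbn [fsubst] in p; rewrite !tsubst_inst_twk in p.
    exact (p e1).
Qed.

(** Leibniz's law in one argument at a time. Compound terms are applications, so the later
    congruences reduce to this one. *)
Global Instance TApp_teq G (H : list (fm G)) s t :
  Proper (@teq G H _ ==> @teq G H _ ==> @teq G H _)%signature (@TApp G s t).
Proof.
  intros f g e1 a b e2; transitivity (g @ a); unfold teq in *.
  - assert (p := @prv_subst_eq _ H _ f g (twk f @ twk a == v0 @ twk a) I e1).
    cbn [fsubst tsubst] in p; rewrite !tsubst_inst_twk in p.
    apply p, prv_EPA, ax_refl.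
  - assert (p := @prv_subst_eq _ H _ a b (twk g @ twk a == twk g @ v0) I e2).
    cbn [fsubst tsubst] in p; rewrite !tsubst_inst_twk in p.
    apply p, prv_EPA, ax_refl.
Qed.

Global Instance tsucc_teq G (H : list (fm G)) :
  Proper (@teq G H _ ==> @teq G H _)%signature (@tsucc G).
Proof. intros a b e; unfold tsucc; now rewrite e. Qed.

Global Instance tplus_teq G (H : list (fm G)) :
  Proper (@teq G H _ ==> @teq G H _ ==> @teq G H _)%signature (@tplus G).
Proof. intros a b e c d e'; unfold tplus, trec; rewrite e, e'; reflexivity. Qed.

(** * Closure properties of the standard objects *)

Lemma prv_st_eq G (H : list (fm G)) t (a b : tm G t) :
  teq H a b -> H |-- FSt a -> H |-- FSt b.
Proof.
  intros e p; eapply prv_impE; [apply prv_ax, ax_st_eq |].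
  apply prv_andI; [exact p | exact e].
Qed.

Lemma prv_st_app G (H : list (fm G)) s t (f : tm G (s ==> t)) a :
  H |-- FSt f -> H |-- FSt a -> H |-- FSt (f @ a).
Proof.
  intros p q; eapply prv_impE; [apply prv_ax, ax_st_app |]; now apply prv_andI.
Qed.

Lemma prv_st_const G (H : list (fm G)) t (c : const t) : H |-- FSt (TConst c).
Proof. apply prv_ax; exact (ax_st_closed (TConst c)). Qed.

Lemma prv_st_succ G (H : list (fm G)) n : H |-- FSt n -> H |-- FSt (tsucc n).
Proof. intros p; apply prv_st_app; [apply prv_st_const | exact p]. Qed.

(** * Combinators and beta conversion *)

Lemma tpi_eq G (H : list (fm G)) s t (a : tm G s) (b : tm G t) :
  teq H (tpi s t @ a @ b) a.
Proof. apply prv_EPA, ax_pi. Qed.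

Lemma tsigma_eq G (H : list (fm G)) r s t (x : tm G (r ==> s ==> t)) y z :
  teq H (tsigma r s t @ x @ y @ z) (x @ z @ (y @ z)).
Proof. apply prv_EPA, ax_sigma. Qed.

(* [lam] does not commute with substitution ([lam (twk a)] is not [tpi _ _ @ a]
   when [a] is an application), so the substitution has to be part of the rule. *)
Lemma beta_subst G D (H : list (fm D)) (f : sub G D) s t (u : tm (s :: G) t)
  (a : tm D s) :
  teq H (tsubst f (lam u) @ a) (tsubst (scons (P := tm D) a f) u).
Proof.
  induction u as [t x | t c | t1 t2 u1 IH1 u2 IH2]; cbn [lam tsubst].
  - pattern t, x; apply var_cons_ind; clear; intros; cbn.
    (* Variable 0 is abstracted to the identity combinator S K K. *)
    + change (teq H (tsigma s (s ==> s) s @ tpi s (s ==> s) @ tpi s s @ a) a).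
      now rewrite tsigma_eq, tpi_eq.
    + apply tpi_eq.
  - apply tpi_eq.
  - change (teq H (tsigma s t1 t2 @ tsubst f (lam u1) @ tsubst f (lam u2) @ a)
      (tsubst (scons (P := tm D) a f) u1 @ tsubst (scons (P := tm D) a f) u2)).
    now rewrite tsigma_eq, IH1, IH2.
Qed.

Lemma beta G (H : list (fm G)) s t (u : tm (s :: G) t) a :
  teq H (lam u @ a) (tsubst (inst a) u).
Proof. rewrite <- (tsubst_id (lam u)); apply beta_subst. Qed.

(** * Arithmetic *)

Lemma tplus0 G (H : list (fm G)) a : teq H (tplus a tzero) a.
Proof. apply prv_EPA, ax_rec0. Qed.

Lemma tplusS G (H : list (fm G)) a b :
  teq H (tplus a (tsucc b)) (tsucc (tplus a b)).
Proof.
  unfold tplus at 1; transitivity (lam (lam (tsucc v1)) @ tplus a b @ b).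
  - apply prv_EPA, ax_recS.
  - rewrite beta, beta_subst; reflexivity.
Qed.

Lemma prv_ind G (H : list (fm G)) A : internal A ->
  H |-- fsubst (inst tzero) A ->
  A :: map (@fwk G Nat) H |-- fsubst inst_succ A ->
  forall n, H |-- fsubst (inst n) A.
Proof.
  intros i p q n; apply prv_allE.
  eapply prv_impE; [eapply prv_impE |]; [apply prv_EPA, ax_ind, i | exact p |].
  now apply prv_allI, prv_impI.
Qed.

(** The step is required in every context [K] that proves the equation, so the induction hypothesis
    is all that it can rely on. *)
Lemma teq_ind G (H : list (fm G)) t (u v : tm (Nat :: G) t) :
  teq H (tsubst (inst tzero) u) (tsubst (inst tzero) v) ->
  (forall K, teq K u v -> teq K (tsubst inst_succ u) (tsubst inst_succ v)) ->
  forall n, teq H (tsubst (inst n) u) (tsubst (inst n) v).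
Proof.
  intros p q n; apply (@prv_ind G H (u == v) I p); apply q, prv_head.
Qed.

Lemma tplus_succ_l G (H : list (fm G)) a b :
  teq H (tplus (tsucc a) b) (tsucc (tplus a b)).
Proof.
  (* Induction on [b], which takes the place of [v0]; instantiation turns the weakened parameters
     back into the original ones. *)
  assert (q := @teq_ind G H _
    (tplus (tsucc (twk a)) v0) (tsucc (tplus (twk a) v0))).
  simpl_subst_in q; specialize (fun x y => q x y b).
  simpl_subst_in q; apply q; [now rewrite !tplus0 |].
  intros K e; now rewrite !tplusS, e.
Qed.

Lemma tplus_right_comm G (H : list (fm G)) a b c :
  teq H (tplus (tplus a b) c) (tplus (tplus a c) b).
Proof.
  assert (q := @teq_ind G H _
    (tplus (tplus (twk a) (twk b)) v0) (tplus (tplus (twk a) v0) (twk b))).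
  simpl_subst_in q; specialize (fun x y => q x y c).
  simpl_subst_in q; apply q; [now rewrite !tplus0 |].
  intros K e; now rewrite !tplusS, tplus_succ_l, e.
Qed.

Lemma tplus_assoc G (H : list (fm G)) a b c :
  teq H (tplus a (tplus b c)) (tplus (tplus a b) c).
Proof.
  assert (q := @teq_ind G H _
    (tplus (twk a) (tplus (twk b) v0)) (tplus (tplus (twk a) (twk b)) v0)).
  simpl_subst_in q; specialize (fun x y => q x y c).
  simpl_subst_in q; apply q; [now rewrite !tplus0 |].
  intros K e; now rewrite !tplusS, e.
Qed.

Lemma tsucc_inj G (H : list (fm G)) a b : teq H (tsucc a) (tsucc b) -> teq H a b.
Proof. intros e; eapply prv_impE; [apply prv_EPA, ax_succ_inj | exact e]. Qed.

Lemma tsucc_neq0 G (H : list (fm G)) a C : teq H (tsucc a) tzero -> H |-- C.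
Proof.
  intros e; apply prv_botE; eapply prv_impE;
    [apply prv_EPA, ax_succ_neq0 | exact e].
Qed.

(** Internal induction shows that every number is zero or a successor; in the second premise [v0] is
    the predecessor. *)
Lemma prv_nat_cases G (H : list (fm G)) n C :
  (n == tzero) :: H |-- C ->
  (twk n == tsucc v0) :: map (@fwk G Nat) H |-- fwk C -> H |-- C.
Proof.
  intros p q.
  assert (r := @prv_ind G H (v0 == tzero \./ FEx Nat (twk v0 == tsucc v0))
    (conj I I)).
  specialize (fun x y => r x y n); simpl_subst_in r.
  eapply prv_orE; [apply r | exact p |].
  - apply prv_orI1, prv_EPA, ax_refl.
  - apply prv_orI2, prv_exI with v0; simpl_subst; apply prv_EPA, ax_refl.
  - eapply prv_exE; [apply prv_head |].
    apply (prv_weaken q), incl_head; cbn; now apply incl_tl, incl_refl.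
Qed.

(** * External induction; standard against infinite numbers *)

Lemma prv_ext_ind G (H : list (fm G)) A :
  H |-- fsubst (inst tzero) A ->
  A :: FSt v0 :: map (@fwk G Nat) H |-- fsubst inst_succ A ->
  forall n, H |-- FSt n -> H |-- fsubst (inst n) A.
Proof.
  intros p q n st; apply prv_impE with (FSt n); [| exact st].
  apply (@prv_allE _ _ H Nat (FSt v0 -.> A) n).
  eapply prv_impE; [apply prv_ax, ax_ext_ind |].
  apply prv_andI; [exact p |].
  now apply prv_allI, prv_impI, prv_impI.
Qed.

(** External induction on [n], for all [d] and [k] at once, with cases on [k]. Zero is standard. If
    [k] is the successor of [k'], then [n] cannot be zero, and cancelling a successor on both sides
    lets the induction hypothesis make [k'] standard. *)
Lemma prv_st_tplus_r G (H : list (fm G)) d k n :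
  H |-- FSt n -> teq H (tplus d k) n -> H |-- FSt k.
Proof.
  intros st e.
  (* Under the quantifiers, variable 0 is [d], variable 1 is [k] and variable 2 is the induction
     variable. *)
  assert (p := @prv_ext_ind G H (FAll Nat (FAll Nat
    (tplus v0 (twk v0) == twk (twk v0) -.> FSt (twk v0))))).
  specialize (fun x y => p x y n st); simpl_subst_in p.
  assert (q : H |-- FAll Nat (FAll Nat
    (tplus v0 (twk v0) == twk (twk n) -.> FSt (twk v0)))).
  2: { spec q k; spec q d; now apply prv_impE with (tplus d k == n). }
  apply p; clear.
  - apply prv_allI, prv_allI, prv_impI, prv_nat_cases with (twk v0).
    + apply prv_st_eq with tzero; [symmetry; apply prv_head | apply prv_st_const].
    + name_hyps K.
      assert (e1 : teq K (twk (twk v0)) (tsucc v0)) by hyp.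
      assert (e2 : teq K (tplus (twk v0) (twk (twk v0))) tzero) by hyp.
      clearbody K.
      rewrite e1, tplusS in e2; exact (tsucc_neq0 _ e2).
  - apply prv_allI, prv_allI, prv_impI, prv_nat_cases with (twk v0).
    + apply prv_st_eq with tzero; [symmetry; apply prv_head | apply prv_st_const].
    + name_hyps K.
      assert (e1 : teq K (twk (twk v0)) (tsucc v0)) by hyp.
      assert (e2 : teq K (tplus (twk v0) (twk (twk v0)))
        (twk (twk (twk (tsucc v0))))) by hyp.
      assert (IH : K |-- FAll Nat (FAll Nat
        (tplus v0 (twk v0) == twk (twk (twk (twk (twk v0)))) -.> FSt (twk v0))))
        by hyp.
      clearbody K.
      simpl_subst_in e2.
      rewrite e1, tplusS in e2; apply tsucc_inj in e2.
      (* The induction hypothesis is taken at the predecessor of [k] and at the same [d]. *)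
      spec IH (@v0 (Nat :: Nat :: Nat :: G) Nat).
      spec IH (twk (s := Nat) (@v0 (Nat :: Nat :: G) Nat)).
      apply prv_st_eq with (tsucc v0); [symmetry; exact e1 |].
      apply prv_st_succ, (prv_impE IH), e2.
Qed.

Lemma prv_le_intro G (H : list (fm G)) k n d :
  teq H n (tplus d k) -> H |-- FLe k n.
Proof. intros e; apply prv_exI with d; simpl_subst; exact e. Qed.

Lemma prv_le_eq G (H : list (fm G)) k k' n n' :
  teq H k k' -> teq H n n' -> H |-- FLe k n -> H |-- FLe k' n'.
Proof.
  intros e1 e2 p.
  assert (q := @prv_subst_eq _ H _ k k' (FLe v0 (twk n)) I e1).
  simpl_subst_in q; apply q in p; clear q.
  assert (q := @prv_subst_eq _ H _ n n' (FLe (twk k') v0) I e2).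
  simpl_subst_in q; exact (q p).
Qed.

Lemma prv_le_tplus G (H : list (fm G)) k n m :
  H |-- FLe k n -> H |-- FLe k (tplus n m).
Proof.
  intros p; eapply prv_exE; [exact p |].
  simpl_subst; name_hyps K.
  assert (e : teq K (twk n) (tplus v0 (twk k))) by hyp.
  clearbody K; apply prv_le_intro with (tplus v0 (twk m)).
  now rewrite e, tplus_right_comm.
Qed.

Lemma prv_inf_contra G (H : list (fm G)) n C :
  H |-- FInf n -> H |-- FSt n -> H |-- C.
Proof. intros p q; apply prv_botE, (prv_impE p q). Qed.

(** External induction on [k], for all infinite [n] at once. An infinite [n] is not zero, and its
    predecessor is again infinite since standardness is closed under successor; the induction
    hypothesis applies to that predecessor. *)
Lemma prv_le_inf G (H : list (fm G)) k n :
  H |-- FSt k -> H |-- FInf n -> H |-- FLe k n.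
Proof.
  intros st inf.
  assert (p := @prv_ext_ind G H (FAllInf (FLe (twk v0) v0))).
  specialize (fun x y => p x y k st); unfold FAllInf in p; simpl_subst_in p.
  assert (q : H |-- FAllInf (FLe (twk k) v0)).
  2: { spec q n; now apply prv_impE with (FInf n). }
  apply p; clear; apply prv_allI, prv_impI.
  - apply prv_le_intro with v0; symmetry; apply tplus0.
  - apply prv_nat_cases with v0.
    + apply prv_inf_contra with v0; [hyp |].
      apply prv_st_eq with tzero; [symmetry; apply prv_head | apply prv_st_const].
    + simpl_subst; name_hyps K.
      assert (e : teq K (twk v0) (tsucc v0)) by hyp.
      assert (inf : K |-- FInf (twk v0)) by hyp.
      assert (IH : K |-- FAllInf (FLe (twk (twk (twk v0))) v0)) by hyp.
      clearbody K; spec IH (@v0 (Nat :: Nat :: G) Nat).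
      assert (inf' : K |-- FInf v0).
      { apply prv_impI; apply prv_inf_contra with (twk v0); [now apply prv_tail |].
        apply prv_st_eq with (tsucc v0);
          [symmetry; now apply prv_tail | apply prv_st_succ, prv_head]. }
      apply (prv_impE IH) in inf'.
      eapply prv_cut; [exact e |].
      eapply prv_exE; [apply prv_tail, inf' |].
      clear; simpl_subst; name_hyps K'.
      assert (e1 : teq K' (twk (twk v0)) (tsucc (twk v0))) by hyp.
      assert (e2 : teq K' (twk v0) (tplus v0 (twk (twk (twk v0))))) by hyp.
      clearbody K'; apply prv_le_intro with v0.
      now rewrite e1, e2, tplusS.
Qed.

Lemma prv_le_trans G (H : list (fm G)) k m n :
  H |-- FLe k m -> H |-- FLe m n -> H |-- FLe k n.
Proof.
  intros p q; eapply prv_cut; [exact p |].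
  eapply prv_exE; [apply prv_tail, q |].
  cbn [map]; rewrite !fwk_FLe.
  eapply prv_exE; [apply prv_tail, prv_head |].
  cbn [map]; rewrite !fwk_FLe; name_hyps K.
  assert (e1 : teq K (twk (twk m)) (tplus v0 (twk (twk k)))) by hyp.
  assert (e2 : teq K (twk (twk n)) (tplus (twk v0) (twk (twk m)))) by hyp.
  clearbody K; apply prv_le_intro with (tplus (twk v0) v0).
  now rewrite e2, e1, tplus_assoc.
Qed.

(** * Bounding a finite sequence *)

(** A closed term seen in an arbitrary context: it is standard there by [ax_st_closed] and fixed by
    every substitution. *)
Definition tclosed {G t} (u : tm [] t) : tm G t := tsubst sub_nil u.

Lemma tsubst_tclosed G D (f : sub G D) t (u : tm [] t) :
  tsubst f (tclosed u) = tclosed u.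
Proof.
  unfold tclosed; rewrite tsubst_comp; apply tsubst_ext.
  intros r x; pattern r, x; apply var_nil_ind.
Qed.

Lemma twk_tclosed G s t (u : tm [] t) :
  twk (s := s) (tclosed (G := G) u) = tclosed u.
Proof. apply tsubst_tclosed. Qed.

Lemma prv_st_tclosed G (H : list (fm G)) t (u : tm [] t) :
  H |-- FSt (tclosed u).
Proof. apply prv_ax, ax_st_closed. Qed.

(** The abstraction is carried out over a context holding only the sequence, and [l] is substituted
    afterwards. As [lam] does not commute with substitution, this is what makes [tsum_step] do
    so. *)
Definition tsum_step {G} (l : tm G (Seq Nat)) : tm G (Nat ==> Nat ==> Nat) :=
  tsubst (scons (P := tm G) l sub_nil)
    (lam (lam (tplus (twk v0) (tnth (twk (twk v0)) v0)))).

Definition tsum_below {G} (l : tm G (Seq Nat)) (n : tm G Nat) : tm G Nat :=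
  trec n tzero (tsum_step l).

Lemma tsubst_tsum_below G D (f : sub G D) l n :
  tsubst f (tsum_below l n) = tsum_below (tsubst f l) (tsubst f n).
Proof.
  apply (f_equal (trec (tsubst f n) tzero)).
  unfold tsum_step; rewrite tsubst_comp; apply tsubst_ext.
  apply var_cons_ind; [reflexivity |].
  intros t x; pattern t, x; apply var_nil_ind.
Qed.

Lemma twk_tsum_below G s (l : tm G (Seq Nat)) n :
  twk (s := s) (tsum_below l n) = tsum_below (twk l) (twk n).
Proof. apply tsubst_tsum_below. Qed.

#[local] Hint Rewrite tsubst_tsum_below : tm_subst.

Global Instance tsum_below_teq G (H : list (fm G)) l :
  Proper (@teq G H _ ==> @teq G H _)%signature (tsum_below l).
Proof. intros a b e; unfold tsum_below, trec; now rewrite e. Qed.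

Lemma tsum_belowS G (H : list (fm G)) l n :
  teq H (tsum_below l (tsucc n)) (tplus (tsum_below l n) (tnth l n)).
Proof.
  unfold tsum_below at 1; transitivity (tsum_step l @ tsum_below l n @ n).
  - apply prv_EPA, ax_recS.
  - unfold tsum_step; rewrite !beta_subst, tsubst_tplus, tsubst_tnth; reflexivity.
Qed.

(** Induction on [e]. The upper end, [i] plus a successor, is the form in which [FLt] presents an
    index below the length. *)
Lemma prv_nth_le_sum_below G (H : list (fm G)) l i e :
  H |-- FLe (tnth l i) (tsum_below l (tplus i (tsucc e))).
Proof.
  assert (q := @prv_ind G H (FLe (tnth (twk l) (twk i))
    (tsum_below (twk l) (tplus (twk i) (tsucc v0)))) I).
  specialize (fun x y => q x y e); simpl_subst_in q; apply q; clear.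
  (* For [e] zero the entry is the last summand, and the difference is the sum of the earlier
     ones. *)
  - apply prv_le_intro with (tsum_below l i).
    rewrite tplusS, tplus0; apply tsum_belowS.
  - name_hyps K.
    assert (IH : K |-- FLe (tnth (twk l) (twk i))
      (tsum_below (twk l) (tplus (twk i) (tsucc v0)))) by hyp.
    clearbody K; eapply prv_le_eq; [reflexivity | | apply prv_le_tplus, IH].
    rewrite (tplusS K (twk i) (tsucc v0)); symmetry; apply tsum_belowS.
Qed.

Lemma prv_in_le_sum_below G (H : list (fm G)) k l :
  H |-- FIn k l -> H |-- FLe k (tsum_below l (tlen l)).
Proof.
  intros p; eapply prv_exE; [exact p |]; clear p.
  (* This unpacks [FLt]: the index becomes [twk v0], and [v0] is the distance to the length, less
     one. *)
  eapply prv_exE; [eapply prv_andE1, prv_head |].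
  rewrite !fwk_FLe, !twk_tsum_below; name_hyps K.
  assert (e1 : teq K (tplus (twk v0) (tsucc v0)) (tlen (twk (twk l)))) by hyp.
  assert (e2 : teq K (twk (twk k)) (tnth (twk (twk l)) (twk v0)))
    by (eapply prv_andE2; hyp).
  clearbody K; eapply prv_le_eq;
    [symmetry; exact e2 | | exact (prv_nth_le_sum_below _ _ _ v0)].
  rewrite e1; reflexivity.
Qed.

(* Stated existentially to keep the large combinator term out of later
   conversion problems. *)
Lemma closed_bound_exists : exists u : tm [] (Seq Nat ==> Nat),
  forall G (H : list (fm G)) k l,
    H |-- FIn k l -> H |-- FLe k (tclosed u @ l).
Proof.
  exists (lam (trec (tlen v0) tzero
    (lam (lam (tplus (twk v0) (tnth (twk (twk v0)) v0)))))).
  intros G H k l p; eapply prv_le_eq; [reflexivity | | ].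
  (* The reduct is convertible to [tsum_below l (tlen l)], because [tsum_step] is defined by the
     same substitution of [l]. *)
  - symmetry; apply beta_subst.
  - exact (prv_in_le_sum_below p).
Qed.

(** * Underspill *)

Lemma up_ext G D s (f g : sub G D) : (forall t x, f t x = g t x) ->
  forall t (x : var (s :: G) t), up f x = up g x.
Proof.
  intros E; apply var_cons_ind; [reflexivity |].
  intros t y; exact (f_equal (tsubst shift) (E t y)).
Qed.

Lemma fsubst_ext G (A : fm G) : forall D (f g : sub G D),
  (forall t x, f t x = g t x) -> fsubst f A = fsubst g A.
Proof.
  induction A; intros D f g E; cbn [fsubst]; f_equal;
    auto using tsubst_ext, up_ext.
Qed.

Lemma up_comp G D K s (f : sub G D) (g : sub D K) t (x : var (s :: G) t) :
  tsubst (up g) (up f x) = up (fun t x => tsubst g (f t x)) x.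
Proof.
  revert t x; apply var_cons_ind; [reflexivity | intros; apply tsubst_up_twk].
Qed.

Lemma fsubst_comp G (A : fm G) : forall D K (f : sub G D) (g : sub D K),
  fsubst g (fsubst f A) = fsubst (fun t x => tsubst g (f t x)) A.
Proof.
  induction A; intros D K f g; cbn [fsubst]; f_equal; auto using tsubst_comp;
    rewrite IHA; apply fsubst_ext; intros; apply up_comp.
Qed.

Lemma fsubst_id G (A : fm G) : fsubst (fun t x => TVar x) A = A.
Proof.
  induction A; cbn [fsubst]; f_equal; auto using tsubst_id;
    rewrite <- IHA at 2; apply fsubst_ext; apply var_cons_ind; reflexivity.
Qed.

(** Instantiating a lifted quantified hypothesis is a single substitution into its matrix: with [v0]
    it gives back [A], and with [tsucc v0] it is [inst_succ]. *)
Lemma fsubst_inst_up_shift G s (A : fm (s :: G)) a :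
  fsubst (inst a) (fsubst (up shift) A) = fsubst (scons (P := tm (s :: G)) a shift) A.
Proof.
  rewrite fsubst_comp; apply fsubst_ext; apply var_cons_ind; reflexivity.
Qed.

Lemma fsubst_v0_shift G s (A : fm (s :: G)) :
  fsubst (scons (P := tm (s :: G)) v0 shift) A = A.
Proof.
  rewrite <- fsubst_id; apply fsubst_ext; apply var_cons_ind; reflexivity.
Qed.

(* If no standard number satisfies [A], then [A] defines the infinite numbers,
   so its negation is an internal inductive property that fails at [m]. *)
Lemma prv_underspill G (H : list (fm G)) A m : internal A ->
  H |-- FInf m -> H |-- FAllInf A -> H |-- FExSt A.
Proof.
  intros i inf p'; eapply prv_cut; [exact p' |].
  apply prv_tail with (A := FAllInf A) in inf.
  assert (p := prv_head (@P_ax) H (FAllInf A)).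
  apply prv_raa.
  set (K := (\neg FExSt A) :: FAllInf A :: H).
  apply prv_impE with (fsubst (inst m) A).
  (* Internal induction refutes [A] at [m], whereas [m] is infinite and so satisfies [A]. *)
  - apply (@prv_ind G K (\neg A) (conj i I)).
    + apply prv_impI; eapply prv_impE; [apply prv_tail, prv_head |].
      apply prv_exI with tzero; cbn [fsubst]; apply prv_andI.
      * apply prv_st_const.
      * apply prv_head.
    + cbn [fsubst]; apply prv_impI; name_hyps L.
      assert (nA : L |-- \neg A) by hyp.
      assert (AS : L |-- fsubst inst_succ A) by hyp.
      assert (ne : L |-- \neg fwk (FExSt A)) by hyp.
      assert (inf' : L |-- fwk (FAllInf A)) by hyp.
      clearbody L.
      apply (prv_impE nA).
      (* The goal [A] now reads as the lifted hypothesis on infinite numbers taken at [v0], so it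
         remains to see that [v0] is infinite. *)
      rewrite <- fsubst_v0_shift, <- fsubst_inst_up_shift.
      apply prv_impE with (FInf v0);
        [exact (prv_allE v0 inf') |].
      (* If [v0] were standard, its successor would be a standard witness of [A]. *)
      apply prv_impI; eapply prv_impE; [apply prv_tail, ne |].
      apply prv_exI with (tsucc v0); cbn [fsubst]; apply prv_andI.
      * apply prv_st_succ, prv_head.
      * rewrite fsubst_inst_up_shift; apply prv_tail, AS.
  - apply prv_tail, prv_impE with (FInf m); [exact (prv_allE m p) | exact inf].
Qed.

(** * The comprehension principle *)

(** Stated without [FSt], hence internal, as both underspill and [ax_HAC] require. *)
Definition stable {G s} (F : tm G (s ==> Nat ==> Nat)) x k : fm G :=
  FAll Nat (twk F @ twk x @ tplus v0 (twk k) == twk F @ twk x @ twk k).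

Lemma fsubst_stable G D (f : sub G D) s (F : tm G (s ==> Nat ==> Nat)) x k :
  fsubst f (stable F x k) = stable (tsubst f F) (tsubst f x) (tsubst f k).
Proof. unfold stable; simpl_subst; reflexivity. Qed.

Lemma fwk_stable G r s (F : tm G (s ==> Nat ==> Nat)) x k :
  fwk (s := r) (stable F x k) = stable (twk F) (twk x) (twk k).
Proof. apply fsubst_stable. Qed.

Lemma fwk_Omega_invariant G r s (F : tm G (s ==> Nat ==> Nat)) M :
  fwk (s := r) (Omega_invariant F M) = Omega_invariant (twk F) (twk M).
Proof.
  unfold fwk, Omega_invariant, FAllSt, FAllInf; simpl_subst; reflexivity.
Qed.

#[local] Hint Rewrite fsubst_stable : tm_subst.

Lemma stable_le G (H : list (fm G)) s (F : tm G (s ==> Nat ==> Nat)) x k n :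
  H |-- stable F x k -> H |-- FLe k n -> teq H (F @ x @ n) (F @ x @ k).
Proof.
  intros p q; eapply prv_cut; [exact p |].
  eapply prv_exE; [apply prv_tail, q |].
  name_hyps K.
  assert (e : teq K (twk n) (tplus v0 (twk k))) by hyp.
  assert (r : K |-- stable (twk F) (twk x) (twk k))
    by (rewrite <- fwk_stable; hyp).
  clearbody K; spec r (@v0 G Nat).
  change (teq K (twk F @ twk x @ twk n) (twk F @ twk x @ twk k)).
  rewrite e; exact r.
Qed.

Lemma Omega_invariant_stable G (H : list (fm G)) s
  (F : tm G (s ==> Nat ==> Nat)) M :
  H |-- FInf M -> H |-- Omega_invariant F M ->
  H |-- FAllSt (FExSt (stable (twk (twk F)) (twk v0) v0)).
Proof.
  intros inf inv.
  eapply prv_cut; [exact inf |]; apply prv_tail with (A := FInf M) in inv.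
  eapply prv_cut; [exact inv |]; clear; apply prv_allI, prv_impI.
  (* [M] also serves as the infinite number at which underspill gets its contradiction. *)
  apply prv_underspill with (twk M); [exact I | hyp |].
  apply prv_allI, prv_impI, prv_allI; name_hyps K.
  assert (st : K |-- FSt (twk (twk v0))) by hyp.
  assert (inf : K |-- FInf (twk v0)) by hyp.
  assert (inv : K |-- Omega_invariant (twk (twk (twk F))) (twk (twk (twk M))))
    by (rewrite <- !fwk_Omega_invariant; hyp).
  clearbody K.
  spec inv (twk (s := Nat) (twk (s := Nat) (@v0 G s))).
  apply prv_impE with (2 := st) in inv; rename inv into inv'.
  assert (inv : forall n, K |-- FInf n ->
    teq K (twk (twk (twk F)) @ twk (twk v0) @ twk (twk (twk M)))
          (twk (twk (twk F)) @ twk (twk v0) @ n)).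
  { intros n i; assert (inv := inv'); spec inv n; exact (prv_impE inv i). }
  match goal with |- prv _ _ (?u == ?v) => change (teq K u v) end.
  (* Both values are compared with the one at [M]; what remains is that [d + k] is infinite, and if
     it were standard then so would be [k]. *)
  etransitivity; [symmetry; apply inv | apply inv, inf].
  apply prv_impI; eapply prv_inf_contra; [apply prv_tail, inf |].
  eapply prv_st_tplus_r; [apply prv_head | reflexivity].
Qed.

Lemma prv_HAC G (H : list (fm G)) r t (A : fm (t :: r :: G)) : internal A ->
  H |-- FAllSt (FExSt A) ->
  H |-- FExSt (s := r ==> Seq t) (FAllSt (s := r) (FEx t
          (FIn v0 (v2 @ v1) /.\ fsubst (up (up shift)) A))).
Proof. intros i p; eapply prv_impE; [now apply prv_ax, ax_HAC | exact p]. Qed.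

(** The property of the choice function that [prv_HAC] yields for stability. *)
Definition selects {G s} (F : tm G (s ==> Nat ==> Nat)) (f : tm G (s ==> Seq Nat)) :
  fm G :=
  FAllSt (s := s) (FEx Nat (FIn v0 (twk (twk f) @ twk v0) /.\
    stable (twk (twk F)) (twk v0) v0)).

Lemma fwk_selects G r s (F : tm G (s ==> Nat ==> Nat)) f :
  fwk (s := r) (selects F f) = selects (twk F) (twk f).
Proof. unfold fwk, selects, FAllSt; simpl_subst; reflexivity. Qed.

(** Some stable [k] lies in [f x]. The bound [u] of [f x] is at least [k], and being standard it is
    at most [n]; hence both sides equal the value of [F] at [x] and [k]. *)
Lemma selects_limit (u : tm [] (Seq Nat ==> Nat))
  (Hu : forall G (H : list (fm G)) k l,
     H |-- FIn k l -> H |-- FLe k (tclosed u @ l))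
  G (H : list (fm G)) s (F : tm G (s ==> Nat ==> Nat)) f x n :
  H |-- FSt f -> H |-- selects F f -> H |-- FSt x -> H |-- FInf n ->
  teq H (F @ x @ (tclosed u @ (f @ x))) (F @ x @ n).
Proof.
  intros stf p stx inf.
  assert (le : H |-- FLe (tclosed u @ (f @ x)) n).
  { apply prv_le_inf; [| exact inf].
    apply prv_st_app; [apply prv_st_tclosed | now apply prv_st_app]. }
  spec p x; apply prv_impE with (2 := stx) in p.
  eapply prv_cut; [exact le |]; eapply prv_exE; [apply prv_tail, p |].
  name_hyps K.
  assert (bd : K |-- FIn v0 (twk f @ twk x)) by (eapply prv_andE1; hyp).
  assert (sb : K |-- stable (twk F) (twk x) v0) by (eapply prv_andE2; hyp).
  assert (le' : K |-- fwk (FLe (tclosed u @ (f @ x)) n)) by hyp.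
  clearbody K; rewrite fwk_FLe, !twk_TApp, twk_tclosed in le'.
  change (teq K (twk F @ twk x @ (twk (tclosed u) @ (twk f @ twk x)))
    (twk F @ twk x @ twk n)).
  rewrite twk_tclosed; apply Hu in bd.
  rewrite (stable_le sb bd), (stable_le sb (prv_le_trans bd le')); reflexivity.
Qed.

Lemma prv_comprehension G (H : list (fm G)) s (F : tm G (s ==> Nat ==> Nat)) f :
  H |-- FSt F -> H |-- FSt f -> H |-- selects F f ->
  H |-- FExSt (s := s ==> Nat) (FAllSt (s := s) (FAllInf
    (twk (twk v0) @ twk v0 == twk (twk (twk F)) @ twk v0 @ v0))).
Proof.
  intros stF stf p; destruct closed_bound_exists as [u Hu].
  (* [g] maps [x] to [F x (u (f x))], written as S F (S (K u) f). Built by application from standard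
     parts, it is standard. *)
  set (g := tsigma s Nat Nat @ F @ (tsigma s (Seq Nat) Nat @
    (tpi (Seq Nat ==> Nat) s @ tclosed u) @ f)).
  apply prv_exI with g; apply prv_andI.
  { unfold g; repeat apply prv_st_app;
      auto using prv_st_tclosed; apply prv_st_const. }
  unfold FAllSt, FAllInf; simpl_subst.
  eapply prv_cut; [exact stf |]; apply prv_tail with (A := FSt f) in p.
  eapply prv_cut; [exact p |].
  apply prv_allI, prv_impI, prv_allI, prv_impI; name_hyps K.
  assert (stf' : K |-- FSt (twk (twk f))) by hyp.
  assert (p' : K |-- selects (twk (twk F)) (twk (twk f)))
    by (rewrite <- !fwk_selects; hyp).
  assert (stx : K |-- FSt (twk v0)) by hyp.
  assert (inf : K |-- FInf v0) by hyp.
  clearbody K.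
  match goal with |- prv _ _ (?a == ?b) => change (teq K a b) end.
  rewrite <- (selects_limit u Hu stf' p' stx inf).
  unfold g; rewrite !twk_TApp, !twk_tclosed.
  change (teq K (tsigma s Nat Nat @ twk (twk F) @ (tsigma s (Seq Nat) Nat @
    (tpi (Seq Nat ==> Nat) s @ tclosed u) @ twk (twk f)) @ twk v0)
    (twk (twk F) @ twk v0 @ (tclosed u @ (twk (twk f) @ twk v0)))).
  rewrite !tsigma_eq, tpi_eq; reflexivity.
Qed.

Theorem theorem3p7 (s : ty) : P_proves (Omega_CA s).
Proof.
  apply prv_allI, prv_impI, prv_allI, prv_impI, prv_impI; name_hyps K.
  assert (stF : K |-- FSt (twk v0)) by hyp.
  assert (inf : K |-- FInf v0) by hyp.
  assert (inv : K |-- Omega_invariant (twk v0) v0) by hyp.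
  clearbody K.
  assert (p := Omega_invariant_stable inf inv); apply prv_HAC in p; [| exact I].
  eapply prv_cut; [exact stF |]; eapply prv_exE; [apply prv_tail, p |].
  (* Variable 0 is now the choice function, and [F] has moved to position 2; the formula from
     HAC_int agrees with [selects] by conversion. *)
  apply prv_comprehension with (F := twk (twk v0)) (f := v0).
  - hyp.
  - eapply prv_andE1; hyp.
  - eapply prv_andE2; hyp.
Qed.
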